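(* Let $N\ge2$. For each starting point $z$ in the interior of $\mathbb A_N$, the deterministic process $(\widetilde Z_{t,\infty})_{t\ge0}$ with $\widetilde Z_{0,\infty}=z$ satisfies $$e_l(\widetilde Z_{t,\infty})=e^{-l(N-l)t}\,e_l(z)\qquad(l=0,1,\ldots,N,\ t\ge0).$$ Moreover, the limit $Z:=\lim_{t\to\infty}\widetilde Z_{t,\infty}\in\mathbb T^N$ exists and is given by $$Z=\bigl(Z_1,\,Z_1e^{2\pi i/N},\,\ldots,\,Z_1e^{2\pi i(N-1)/N}\bigr),$$ where $Z_1\in\mathbb T$ is as follows: if $z=(e^{ix_1},\ldots,e^{ix_N})$ with $(x_1,\ldots,x_N)\in C_N$, then $$Z_1=e^{ix_0}\quad\text{with}\quad x_0=\frac{x_1+\ldots+x_N-\pi(N-1)}N .$$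
   Context: $e_l$ is the $l$-th elementary symmetric polynomial in $N$ variables; $\mathbb T$ is the complex unit circle. $C_N=\{x\in\mathbb R^N:\ x_1\le x_2\le\ldots\le x_N\le x_1+2\pi\}$, $e^{ix}:=(e^{ix_1},\ldots,e^{ix_N})$, and $\mathbb A_N=\{e^{ix}:x\in C_N\}\subset\mathbb T^N$. The interior of $\mathbb A_N$ is understood as the set of all $e^{ix}$ with $x$ in the interior of $C_N$, i.e. $x_1<x_2<\ldots<x_N<x_1+2\pi$, so that the coordinates of $z$ are pairwise distinct. The deterministic process is $\widetilde Z_{t,\infty}=e^{i\widetilde X_{t,\infty}}$, where $\widetilde X_{t,\infty}=(x_1(t),\ldots,x_N(t))$ is the solution of $$\frac{dx_j}{dt}(t)=\sum_{l\ne j}\cot\Bigl(\frac{x_j(t)-x_l(t)}2\Bigr)\qquad(j=1,\ldots,N)$$ with $\widetilde X_{0,\infty}=x$ in the interior of $C_N$, $e^{ix}=z$; this solution exists for all $t\ge0$ in the interior of $C_N$. *)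

(* Defs.v *)
From HB Require Import structures.
From mathcomp Require Import all_boot all_order all_algebra.
From mathcomp Require Import complex.
From mathcomp Require mpoly.
From mathcomp Require Import classical_sets reals topology normedtype derive.
From mathcomp Require Import sequences realfun exp trigo.

Set Implicit Arguments.
Unset Strict Implicit.
Unset Printing Implicit Defensive.

Import Order.TTheory GRing.Theory Num.Theory.
Import numFieldNormedType.Exports.

Local Open Scope classical_set_scope.
Local Open Scope ring_scope.
Local Open Scope complex_scope.

(* The library derives the topology of a numFieldType from its modulus, but
   does not attach it to the type [R[i]] itself. *)
Set Warnings "-redundant-canonical-projection".
HB.instance Definition _ (R : realType) :=
  NormedModule.copy R[i] ((R[i] : numFieldType)^o).
Set Warnings "redundant-canonical-projection".

Section Defs.
Variable R : realType.

Definition cot (x : R) : R := cos x / sin x.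

Definition expi (x : R) : R[i] := cos x +i* sin x.

Section Dimension.
Variable N : nat.

Definition expi_row (x : 'rV[R]_N) : 'rV[R[i]]_N := map_mx expi x.

Definition elem_sym (l : nat) (z : 'rV[R[i]]_N) : R[i] :=
  mpoly.meval (fun j => z 0 j) (mpoly.mesym N R[i] l).

(* x_1 <= x_2 <= ... <= x_N <= x_1 + 2 pi, spelled out for all index pairs so
   that no first or last index has to be named. *)
Definition C_N : set 'rV[R]_N :=
  [set x | forall i j : 'I_N, (i <= j)%N ->
     x 0 i <= x 0 j <= x 0 i + 2 * pi].

(* Not the topological interior of the image in the torus: the image of the
   topological interior of C_N. *)
Definition interior_A_N : set 'rV[R[i]]_N := expi_row @` interior C_N.

(* A solution on [0, +oo[ : X is continuous there and satisfies the equation at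
   every t > 0. The right-hand side being continuous along X, the one-sided
   equation at t = 0 follows. *)
Definition is_solution (X : R -> 'rV[R]_N) : Prop :=
  [/\ forall t : R, 0 <= t -> interior C_N (X t),
      forall j, {within [set t : R | 0 <= t], continuous (fun t => X t 0 j)} &
      forall j (t : R), 0 < t ->
        is_derive t 1 (fun s => X s 0 j)
          (\sum_(l < N | l != j) cot ((X t 0 j - X t 0 l) / 2))].

Definition deterministic_process (z : 'rV[R[i]]_N) (Z : R -> 'rV[R[i]]_N) :
    Prop :=
  exists X : R -> 'rV[R]_N,
    [/\ is_solution X, expi_row (X 0) = z &
        forall t, 0 <= t -> Z t = expi_row (X t)].

End Dimension.
End Defs.

(* Main.v *)
(* Write a_S for the sum of the x_j over j in S. Then e_l(e^{ix}) is the sum of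
   e^{i a_S} over the l-subsets S. Along the flow, the cotangents of pairs
   inside S cancel, and exchanging j in S with k outside S pairs up the others
   by (sin(u - d) - sin u) cot(d/2) = -(cos u + cos(u - d)). There are l(N-l)
   such exchanges for each S, so e_l' = -l(N-l) e_l.
   For the limit, let p be the monic polynomial with roots z_j = e^{i x_j(t)}. For
   large t it is close to X^N - c with |c| = 1. From p(z_j) = 0, the angle
   N x_j is close to arg c modulo 2 pi; from p'(z_j) close to N z_j^{N-1}, the
   roots stay apart. So the integers m_j nearest to (N x_j - arg c) / (2 pi)
   increase strictly with m_N < m_1 + N, i.e. m_j = m_1 + j - 1, and the
   conserved sum of the x_j forces m_1 = 0. *)

Require Import Defs.
From mathcomp Require Import all_boot all_order all_algebra.
From mathcomp Require Import complex.
From mathcomp Require Import classical_sets reals topology normedtype derive.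
From mathcomp Require Import sequences realfun exp trigo.
From mathcomp Require Import boolp functions ring lra zify.
(* Importing all of mpoly would clash with the notations of MathComp-Analysis. *)
From mathcomp Require Import (canonicals) mpoly.

Set Implicit Arguments.
Unset Strict Implicit.
Unset Printing Implicit Defensive.

Import Order.TTheory GRing.Theory Num.Theory.
Import numFieldNormedType.Exports.

Local Open Scope classical_set_scope.
Local Open Scope ring_scope.
Local Open Scope complex_scope.

(** * Combinatorics of sums over subsets *)

(** Exchanging the two summation indices turns the sum [s] into [- s]. *)
Lemma sum_antisym_eq0 (V : numDomainType) (I : finType) (A : {set I}) (H : I -> I -> V) :
  (forall j k, H j k = - H k j) ->
  \sum_(j in A) \sum_(k in A | k != j) H j k = 0.
Proof.
move=> HN; set s := LHS; suff sE : s = - s by apply/eqP; rewrite -eqNr eq_sym -sE.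
rewrite {1}/s (exchange_big_dep [in A]) /=; last by move=> j k _ /andP[].
rewrite -sumrN; apply: eq_bigr => k kA; rewrite -sumrN.
by apply: eq_big => [j | j _]; rewrite ?kA //= eq_sym andbC.
Qed.

(** Reindexing along the involution [h], which trades [j] in [S] for [k] outside it: the size of [S]
    is kept, and [j] and [k] swap roles. *)
Lemma sum_set_exchange (V : nmodType) (I : finType) (l : nat)
    (G : {set I} -> I -> I -> V) :
  \sum_(S : {set I} | #|S| == l) \sum_(j in S) \sum_(k | k \notin S) G S j k =
  \sum_(S : {set I} | #|S| == l) \sum_(j in S) \sum_(k | k \notin S)
    G (k |: S :\ j) k j.
Proof.
under eq_bigr do rewrite pair_big_dep.
under [RHS]eq_bigr do rewrite pair_big_dep.
rewrite !pair_big_dep /=.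
pose h (p : {set I} * (I * I)) := (p.2.2 |: p.1 :\ p.2.1, (p.2.2, p.2.1)).
have hK (p : {set I} * (I * I)) : p.2.1 \in p.1 -> p.2.2 \notin p.1 -> h (h p) = p.
  case: p => [S [j k]] /= jS kS; rewrite /h /=; congr (_, _).
  have kS' : k \notin S :\ j by rewrite !inE negb_and kS orbT.
  by rewrite setU1K// finset.setD1K.
have hP (p : {set I} * (I * I)) : p.2.1 \in p.1 -> p.2.2 \notin p.1 ->
    [/\ #|(h p).1| = #|p.1|, (h p).2.1 \in (h p).1 & (h p).2.2 \notin (h p).1].
  case: p => [S [j k]] /= jS kS; rewrite /h /=; split.
  - by rewrite cardsU1 [RHS](cardsD1 j) jS !inE negb_and kS orbT.
  - by rewrite !inE eqxx.
  - rewrite !inE eqxx /= orbF; apply: contraNneq kS => <-; exact: jS.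
rewrite (reindex_onto h h) /=; last first.
  by move=> p /andP[_ /andP[pj pk]]; apply: hK.
apply: eq_bigl => p.
apply/idP/idP => [/andP[/andP[cS /andP[j1 k1]]] /eqP hh|/andP[cS /andP[j1 k1]]].
  by have := hP (h p) j1 k1; rewrite hh /= (eqP cS) => -[-> -> ->]; rewrite eqxx.
by have /= [-> -> ->] := hP p j1 k1; rewrite cS hK//= eqxx.
Qed.

(** * Trigonometric identities for the elementary symmetric polynomials on the torus *)

Section Sums.
Variables (R : realType) (N : nat).
Implicit Types (a : 'I_N -> R).

Lemma expiD (x y : R) : expi (x + y) = expi x * expi y.
Proof. by rewrite /expi cosD sinD; simpc; rewrite [X in _ +i* X]addrC. Qed.

Lemma expi0 : expi (0 : R) = 1.
Proof. by rewrite /expi cos0 sin0. Qed.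

Lemma expi_sum (I : finType) (S : {set I}) (a : I -> R) :
  expi (\sum_(j in S) a j) = \prod_(j in S) expi (a j).
Proof. exact: (big_morph _ expiD expi0). Qed.

Lemma elem_sym_expi l (x : 'rV[R]_N) :
  elem_sym l (expi_row x) =
  \sum_(S : {set 'I_N} | #|S| == l) expi (\sum_(j in S) x 0 j).
Proof.
rewrite /elem_sym /mpoly.mesym raddf_sum /=; apply: eq_bigr => S _.
rewrite rmorph_prod expi_sum; apply: eq_bigr => j _ /=.
by rewrite mpoly.mevalXU mxE.
Qed.

(** Around the midpoint [m = u - d / 2], the difference of sines is [-2 cos m sin (d / 2)] and the
    sum of cosines is [2 cos m cos (d / 2)]. *)
Lemma sin_swap_cot (u d : R) : sin (d / 2) != 0 ->
  (sin (u - d) - sin u) * cot (d / 2) = - (cos u + cos (u - d)).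
Proof.
move=> sd0; have [m mE] : exists m, m = u - d / 2 by exists (u - d / 2).
have -> : u - d = m - d / 2 by rewrite mE; lra.
have -> : u = m + d / 2 by rewrite mE; lra.
by rewrite sinB sinD cosB cosD /cot; field.
Qed.

Lemma cot_odd (u : R) : cot (- u) = - cot u.
Proof. by rewrite /cot cosN sinN invrN mulrN. Qed.

Lemma sum_cot_eq0 (A : {set 'I_N}) a :
  \sum_(j in A) \sum_(k in A | k != j) cot ((a j - a k) / 2) = 0.
Proof. by apply: sum_antisym_eq0 => j k; rewrite -cot_odd -mulNr opprB. Qed.

(** Along the flow, the left side is the time derivative of the sum of cosines on the right. The
    phase [phi] lets one real identity serve both the real and the imaginary part of [elem_sym]. *)
Lemma sum_sin_cot a phi (l : nat) :
  (forall j k : 'I_N, j != k -> sin ((a j - a k) / 2) != 0) ->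
  \sum_(S : {set 'I_N} | #|S| == l)
    - sin (\sum_(j in S) a j + phi) *
      \sum_(j in S) \sum_(k < N | k != j) cot ((a j - a k) / 2) =
  - (l%:R * (N%:R - l%:R)) *
    \sum_(S : {set 'I_N} | #|S| == l) cos (\sum_(j in S) a j + phi).
Proof.
move=> sin_neq0; pose c j k := cot ((a j - a k) / 2).
pose u (S : {set 'I_N}) := \sum_(j in S) a j + phi.
have splitS (S : {set 'I_N}) : \sum_(j in S) \sum_(k < N | k != j) c j k =
    \sum_(j in S) \sum_(k | k \notin S) c j k.
  rewrite -[RHS]add0r -[X in X + _](sum_cot_eq0 S a) -big_split /=.
  apply: eq_bigr => j jS; rewrite (bigID [in S]) /=; congr (_ + _).
    by apply: eq_bigl => k; rewrite andbC.
  by apply: eq_bigl => k; case: eqVneq => //= ->; rewrite jS.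
have uswap (S : {set 'I_N}) j k : j \in S -> k \notin S ->
    u (k |: S :\ j) = u S - (a j - a k).
  move=> jS kS; rewrite /u big_setU1 /=; last by rewrite !inE negb_and kS orbT.
  by rewrite [in RHS](big_setD1 j jS) /=; ring.
have card2 (f : {set 'I_N} -> R) :
    \sum_(S : {set 'I_N} | #|S| == l) \sum_(j in S) \sum_(k | k \notin S) f S =
    l%:R * (N%:R - l%:R) * \sum_(S : {set 'I_N} | #|S| == l) f S.
  rewrite mulr_sumr; apply: eq_bigr => S /eqP Sl.
  have lN : (l <= N)%N by rewrite -Sl -[leqRHS]card_ord max_card.
  rewrite !sumr_const Sl -natrB//.
  have -> : #|[pred k | k \notin S]| = (N - l)%N.
    rewrite -[N in RHS]card_ord -(cardsC S) Sl addKn.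
    by apply: eq_card => k; rewrite !inE.
  by rewrite -mulrA !mulr_natl.
set L := LHS.
have L1 : L = \sum_(S : {set 'I_N} | #|S| == l) \sum_(j in S)
    \sum_(k | k \notin S) - sin (u S) * c j k.
  apply: eq_bigr => S _; rewrite splitS mulr_sumr; apply: eq_bigr => j _.
  by rewrite mulr_sumr.
have L2 := L1; rewrite sum_set_exchange in L2.
(* Both sides are doubled, so that each can be written as itself plus its exchanged copy; the
   identity then holds term by term in [S], [j], [k]. *)
apply: (@mulrI _ 2); rewrite ?unitfE ?pnatr_eq0//.
rewrite mulr_natl mulr2n {1}L1 L2 -big_split /=.
have sum_cos := card2 (fun S => cos (u S)).
rewrite mulNr -sum_cos mulrN mulr_natl mulr2n.
rewrite [X in - (X + _)]sum_set_exchange -big_split -sumrN; apply: eq_bigr => S _.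
rewrite -!big_split -sumrN; apply: eq_bigr => j jS.
rewrite -!big_split -sumrN; apply: eq_bigr => k kS /=.
have jk : j != k by apply: contraNneq kS => <-.
rewrite uswap// addrC [cos _ + _]addrC -sin_swap_cot ?sin_neq0//.
have -> : c k j = - c j k by rewrite /c -cot_odd -mulNr opprB.
by rewrite -/(c j k); ring.
Qed.
End Sums.

(** * Scalar linear differential equations on the half-line, and calculus of finite sums *)

Section ODE.
Variable R : realType.
Implicit Types (f : R -> R).

Lemma derive0_cst f :
  {within [set t : R | 0 <= t], continuous f} ->
  (forall t : R, 0 < t -> is_derive t 1 f 0) ->
  forall t, 0 <= t -> f t = f 0.
Proof.
move=> fc fd t; rewrite le_eqVlt => /predU1P[<-//|t0].
have [] := @MVT R f (fun=> 0) 0 t t0.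
- by move=> x /[!in_itv] /= /andP[x0 _]; apply: fd.
- apply: continuous_subspaceW fc => x /=; rewrite in_itv /= => /andP[] //.
- by move=> c _ /eqP; rewrite mul0r subr_eq0 => /eqP.
Qed.

(** Integrating factor: [expR (- c * t) * f t] has zero derivative for [t > 0], hence is constant up
    to [t = 0] by continuity. *)
Lemma linear_ode f (c : R) :
  {within [set t : R | 0 <= t], continuous f} ->
  (forall t : R, 0 < t -> is_derive t 1 f (c * f t)) ->
  forall t, 0 <= t -> f t = expR (c * t) * f 0.
Proof.
move=> fc fd; pose e (s : R) : R := expR (- c * s).
have ed (t : R) : is_derive t 1 e (- c * e t).
  have : is_derive t 1 (expR \o ( *%R (- c))) (expR (- c * t) * (- c)).
    apply: is_derive1_comp.
    have -> : *%R (- c) = (- c) \*: (@id R) by [].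
    rewrite -[X in is_derive _ _ _ X]mulr1.
    exact: is_deriveZ.
  by rewrite mulrC.
have ec : continuous e.
  by move=> t; apply: differentiable_continuous; apply/derivable1_diffP; case: (ed t).
have gE t : 0 <= t -> e t * f t = e 0 * f 0.
  apply: (derive0_cst (f := fun s => e s * f s)).
    by move=> s; apply: continuousM (fc s); apply: continuous_subspaceT.
  move=> s s0; apply: (is_derive_eq (is_deriveM (ed s) (fd s s0))) => /=.
  by rewrite /GRing.scale /=; ring.
move=> t t0; have := gE t t0; rewrite /e mulr0 expR0 mul1r => <-.
by rewrite mulrA -expRD mulNr subrr expR0 mul1r.
Qed.
End ODE.

Lemma is_derive_bigsum (R : realType) (I : finType) (P : pred I)
    (f : I -> R -> R) (d : I -> R) (t : R) :
  (forall i, P i -> is_derive t 1 (f i) (d i)) ->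
  is_derive t 1 (fun s => \sum_(i | P i) f i s) (\sum_(i | P i) d i).
Proof.
move=> fd; have -> : (fun s => \sum_(i | P i) f i s) = \sum_(i | P i) f i.
  by apply/funext => s; rewrite fct_sumE.
apply: (big_ind2 (fun (g : R -> R) b => is_derive t 1 g b)) => //.
- exact: is_derive_cst.
- by move=> ? ? ? ? *; apply: is_deriveD.
Qed.

Lemma continuous_bigsum (T : topologicalType) (R : realType) (I : finType)
    (P : pred I) (f : I -> T -> R) :
  (forall i, P i -> continuous (f i)) ->
  continuous (fun s => \sum_(i | P i) f i s).
Proof.
move=> fc; have -> : (fun s => \sum_(i | P i) f i s) = \sum_(i | P i) f i.
  by apply/funext => s; rewrite fct_sumE.
apply: (big_ind (fun g : T -> R => continuous g)) => //.
- exact: cst_continuous.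
- by move=> g h gc hc s; apply: (cvgD (gc s) (hc s)).
Qed.

(** * Evolution of the elementary symmetric polynomials along a solution *)

Section Flow.
Variables (R : realType) (N : nat).

Definition strict_row (x : 'rV[R]_N) : Prop :=
  forall i j : 'I_N, (i < j)%N -> x 0 i < x 0 j < x 0 i + 2 * pi.

(** Raising a single coordinate by half the radius of a ball inside [C_N] stays in [C_N]: raising
    [x_i] makes the first inequality strict, raising [x_j] the second. *)
Lemma interior_C_N (x : 'rV[R]_N) : interior (@C_N R N) x -> strict_row x.
Proof.
move=> /nbhs_ballP[e /= e0 xe] i j ij.
have ij' : (i == j) = false by apply/negbTE; rewrite neq_ltn ij.
have pert k : C_N (x + \row_l ((e / 2) *+ (l == k))).
  apply: xe; split => // a l; rewrite !mxE ord1 /ball /= opprD addNKr normrN.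
  by case: eqP => _; rewrite ?mulr1n ?mulr0n ?normr0// gtr0_norm; lra.
have := pert i i j (ltnW ij); have := pert j i j (ltnW ij).
rewrite !mxE !eqxx ij' [j == i]eq_sym ij' !mulr1n !mulr0n => /andP[_ h1] /andP[h2 _].
by apply/andP; split; lra.
Qed.

Lemma strict_row_sin (x : 'rV[R]_N) : strict_row x ->
  forall j k : 'I_N, j != k -> sin ((x 0 j - x 0 k) / 2) != 0.
Proof.
move=> xs; have pos (j k : 'I_N) : (j < k)%N -> 0 < sin ((x 0 k - x 0 j) / 2).
  by move=> /xs /andP[h1 h2]; apply: sin_gt0_pi; apply/andP; split; lra.
move=> j k; rewrite neq_ltn => /orP[/pos h|/pos /lt0r_neq0//].
by rewrite -opprB mulNr sinN oppr_eq0 lt0r_neq0.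
Qed.

Variable X : R -> 'rV[R]_N.
Hypothesis Xsol : is_solution X.

Let Xs (t : R) : 0 <= t -> strict_row (X t).
Proof. by case: Xsol => h _ _ /h; apply: interior_C_N. Qed.

Let Xc (S : {set 'I_N}) phi :
  {within [set t : R | 0 <= t], continuous (fun t => \sum_(j in S) X t 0 j + phi)}.
Proof.
case: Xsol => _ Xc _ t; apply: cvgD; last exact: cvg_cst.
by apply: (@continuous_bigsum (subspace [set t : R | 0 <= t])) => j _; apply: Xc.
Qed.

Let Xd (S : {set 'I_N}) phi (t : R) : 0 < t ->
  is_derive t 1 (fun t => \sum_(j in S) X t 0 j + phi)
   (\sum_(j in S) \sum_(k < N | k != j) cot ((X t 0 j - X t 0 k) / 2)).
Proof.
case: Xsol => _ _ Xd t0; rewrite -[X in is_derive _ _ _ X]addr0.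
apply: is_deriveD; apply: is_derive_bigsum => j _; exact: Xd.
Qed.

(** The cotangent is odd, so the velocities sum to zero. *)
Lemma sum_solution (t : R) : 0 <= t -> \sum_j X t 0 j = \sum_j X 0 0 j.
Proof.
have sE s : \sum_j X s 0 j = \sum_(j in [set: 'I_N]%SET) X s 0 j + 0.
  by rewrite addr0; apply: eq_bigl => j; rewrite inE.
move=> t0; rewrite !sE.
apply: (derive0_cst (f := fun s => \sum_(j in [set: 'I_N]%SET) X s 0 j + 0)) => //.
move=> s s0; apply: (is_derive_eq (Xd _ 0 s0)).
rewrite -[RHS](sum_cot_eq0 [set: 'I_N]%SET (fun j => X s 0 j)).
by apply: eq_bigr => j _; apply: eq_bigl => k; rewrite inE.
Qed.

Lemma sum_cos_solution l phi (t : R) : 0 <= t ->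
  \sum_(S : {set 'I_N} | #|S| == l) cos (\sum_(j in S) X t 0 j + phi) =
  expR (- (l%:R * (N%:R - l%:R)) * t) *
  \sum_(S : {set 'I_N} | #|S| == l) cos (\sum_(j in S) X 0 0 j + phi).
Proof.
pose F s := \sum_(S : {set 'I_N} | #|S| == l) cos (\sum_(j in S) X s 0 j + phi).
apply: (linear_ode (f := F)) => [|s s0].
  apply: continuous_bigsum => S _ s.
  by apply: (continuous_comp (@Xc S phi s)); apply: continuous_cos.
rewrite -sum_sin_cot; last by apply: strict_row_sin; apply: Xs; apply: ltW.
apply: is_derive_bigsum => S _.
by apply: is_derive1_comp; apply: Xd.
Qed.

Lemma elem_sym_solution l (t : R) : 0 <= t ->
  elem_sym l (expi_row (X t)) =
  (expR (- (l%:R * (N%:R - l%:R) * t)))%:C * elem_sym l (expi_row (X 0)).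
Proof.
move=> t0; rewrite !elem_sym_expi -mulNr.
(* The imaginary part is a sum of cosines too, with phase [- pi / 2]. *)
have eE s : \sum_(S : {set 'I_N} | #|S| == l) expi (\sum_(j in S) X s 0 j) =
   (\sum_(S : {set 'I_N} | #|S| == l) cos (\sum_(j in S) X s 0 j + 0)) +i*
   (\sum_(S : {set 'I_N} | #|S| == l) cos (\sum_(j in S) X s 0 j - pi / 2)).
  apply/eqP; rewrite eq_complex /= !raddf_sum /=; apply/andP; split; apply/eqP.
    by apply: eq_bigr => S _; rewrite addr0.
  by apply: eq_bigr => S _; rewrite cosBpihalf.
by rewrite !eE !(sum_cos_solution _ _ t0); simpc.
Qed.

End Flow.

(** * Monic polynomials whose middle coefficients are small, on the unit circle *)

Lemma horner_deriv_XsubC_mul (A : comNzRingType) (c : A) (q : {poly A}) :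
  (('X - c%:P) * q)^`().[c] = q.[c].
Proof. by rewrite derivM derivXsubC !hornerE subrr mul0r addr0. Qed.

Section NearXnPoly.
Variables (C : numDomainType) (n : nat) (p : {poly C}) (e w : C).
Hypotheses (p_size : size p = n.+2) (p_lead : p`_n.+1 = 1) (w1 : `|w| = 1).
Hypothesis p_small : forall i, (0 < i <= n)%N -> `|p`_i| <= e.

Lemma norm_horner_near : `|p.[w] - (p`_0 + w ^+ n.+1)| <= e *+ n.
Proof.
rewrite horner_coef p_size big_ord_recl big_ord_recr /= /bump /= p_lead mul1r.
rewrite expr0 mulr1 opprD addrACA subrr add0r addrK.
apply: le_trans (ler_norm_sum _ _ _) _.
rewrite -[in leRHS](card_ord n) -sumr_const; apply: ler_sum => i _.
by rewrite normrM normrX w1 expr1n mulr1; apply: p_small; rewrite /= ltn_ord.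
Qed.

(** Each of the [n] middle coefficients enters the derivative with a factor at most [n], bounded
    here by [n.+1]. *)
Lemma norm_horner_deriv_near :
  `|p^`().[w] - w ^+ n *+ n.+1| <= e *+ n.+1 *+ n.
Proof.
have -> : p^`().[w] = \sum_(i < n.+1) p`_i.+1 *+ i.+1 * w ^+ i.
  rewrite (@horner_coef_wide _ n.+1); last first.
    by rewrite -ltnS -p_size lt_size_deriv// -size_poly_gt0 p_size.
  by apply: eq_bigr => i _; rewrite coef_deriv.
rewrite big_ord_recr /= p_lead mulrnAl mul1r addrK.
apply: le_trans (ler_norm_sum _ _ _) _.
rewrite -[in leRHS](card_ord n) -sumr_const; apply: ler_sum => i _.
rewrite normrM normrX w1 expr1n mulr1 normrMn.
have ep : `|p`_i.+1| <= e by apply: p_small; rewrite /= ltn_ord.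
apply: le_trans (_ : e *+ i.+1 <= _); first by rewrite ler_wMn2r.
rewrite card_ord; apply: ler_wpMn2l; last by rewrite ltnS ltnW.
exact: le_trans ep.
Qed.

End NearXnPoly.

(** Each of the [n] steps raises [m] by at least 1, while the total rise is at most [n], so every
    step is exactly 1. *)
Lemma int_packed_eq n (m : 'I_n.+1 -> int) :
  (forall i j : 'I_n.+1, (i < j)%N -> m i < m j < m i + n.+1%:Z) ->
  forall j, m j = m ord0 + j%:Z.
Proof.
move=> mP.
have step (d : nat) (i j : 'I_n.+1) : j = (i + d)%N :> nat -> m i + d%:Z <= m j.
  elim: d j => [|d IH] j jE.
    have -> : i = j by apply: val_inj; rewrite /= jE addn0.
    by rewrite addr0.
  have id_lt : (i + d < n.+1)%N by have := ltn_ord j; lia.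
  have := IH (Ordinal id_lt) erefl.
  have /= := mP (Ordinal id_lt) j; rewrite jE addnS ltnS leqnn => /(_ isT); lia.
move=> j; have h1 := step j ord0 j erefl.
have jn : (j <= n)%N by rewrite -ltnS.
have h2 : m j + (n - j)%N%:Z <= m ord_max by apply: step; rewrite subnKC.
(* For [n = 0] the first and last index coincide, and the hypothesis says nothing about them. *)
have [n0|n0] := posnP n.
  have -> : j = ord0 by apply: val_inj => /=; lia.
  by rewrite /= addr0.
have := mP ord0 ord_max n0; rewrite /= in h1 *; lia.
Qed.

(** * The map [expi] and its lifts to the real line *)

Section Expi.
Variable R : realType.
Implicit Types (x y u : R).

Lemma norm_expi x : `|expi x| = 1 :> R[i].
Proof. by rewrite normc_def /= cos2Dsin2 sqrtr1. Qed.

Lemma expiN x : expi (- x) * expi x = 1.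
Proof. by rewrite -expiD addNr expi0. Qed.

Lemma expi_pi : expi pi = -1 :> R[i].
Proof. by rewrite /expi cospi sinpi; apply/eqP; rewrite eq_complex /= oppr0 !eqxx. Qed.

Lemma expiNpi : expi (- pi) = -1 :> R[i].
Proof. by rewrite -[LHS]mulr1 -[X in _ * X]opprK -expi_pi mulrN expiN expi_pi. Qed.

Lemma expiMn x n : expi (x *+ n) = expi x ^+ n.
Proof. by elim: n => [|n IH]; rewrite ?mulr0n ?expi0// mulrS exprS expiD IH. Qed.

Lemma expi2pi : expi (2 * pi) = 1 :> R[i].
Proof. by rewrite mulr_natl expiMn expi_pi sqrrN expr1n. Qed.

Lemma expi2piz (m : int) : expi (2 * pi * m%:~R) = 1 :> R[i].
Proof.
have nat_case n : expi (2 * pi * n%:R) = 1 :> R[i].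
  by rewrite mulr_natr expiMn expi2pi expr1n.
case: m => n; first exact: nat_case.
by rewrite NegzE mulrNz mulrN -[LHS]mulr1 -[in LHS](nat_case n.+1) expiN.
Qed.

Lemma lipschitz1_derive (f df : R -> R) : (forall x, is_derive x 1 f (df x)) ->
  (forall x, `|df x| <= 1) -> forall x y, `|f x - f y| <= `|x - y|.
Proof.
move=> fd d1.
suff le x y : x <= y -> `|f x - f y| <= `|x - y|.
  move=> x y; case: (leP x y) => [/le//|/ltW /le].
  by rewrite distrC [leRHS]distrC.
move=> xy; have [|c _ fE] := MVT_segment xy (fun z _ => fd z).
  apply: continuous_subspaceT => z.
  by apply: differentiable_continuous; apply/derivable1_diffP; case: (fd z).
by rewrite distrC [leRHS]distrC fE normrM ler_piMl.
Qed.

(** Cosine and sine are each 1-Lipschitz; adding the two bounds gives the crude constant 2, which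
    suffices below. *)
Lemma norm_expiB x y : `|expi x - expi y| <= (2 * `|x - y|)%:C.
Proof.
have -> : expi x - expi y = (cos x - cos y)%:C + 'i * (sin x - sin y)%:C.
  by rewrite /expi; simpc.
apply: le_trans (ler_normD _ _) _.
rewrite normrM normCi mul1r !normc_def /= expr0n /= !addr0 !sqrtr_sqr.
rewrite -rmorphD lecR mulrDl !mul1r; apply: lerD.
  apply: (lipschitz1_derive (fun z => is_derive_cos z)) => z.
  by rewrite normrN sin_max.
by apply: (lipschitz1_derive (fun z => is_derive_sin z)) => z; apply: cos_max.
Qed.

Lemma cos_near_int u d : 0 < d < pi -> cos d < cos u ->
  exists m : int, `|u - 2 * pi * m%:~R| < d.
Proof.
move=> /andP[d0 dpi] du; have pi0 := pi_gt0 R.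
have pi2 : 0 < 2 * pi :> R by lra.
(* [m] is the integer nearest to [u / (2 * pi)], so the remainder lies in [[-pi, pi]], where the
   cosine decreases in the absolute value. *)
pose m := Num.floor (u / (2 * pi) + 1 / 2); exists m.
have m1 : m%:~R <= u / (2 * pi) + 1 / 2 by exact: floor_le.
have m2 : u / (2 * pi) + 1 / 2 < m%:~R + 1.
  by have := floorD1_gt (u / (2 * pi) + 1 / 2); rewrite intrD.
have uE : u = u / (2 * pi) * (2 * pi) by rewrite divfK// lt0r_neq0.
have cosv : cos (u - 2 * pi * m%:~R) = cos u.
  have /(congr1 (@complex.Re R)) /= : expi (u - 2 * pi * m%:~R) = expi u.
    by rewrite expiD -mulrN -mulrNz expi2piz mulr1.
  by [].
set w := u / (2 * pi) in m1 m2 uE.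
have v1 : `|u - 2 * pi * m%:~R| <= pi.
  by rewrite uE ler_norml; apply/andP; split; nra.
move: du; rewrite -cosv -[cos (u - _)]cos_norm ltr_cos// in_itv /=.
  by rewrite normr_ge0.
by rewrite !ltW.
Qed.

Lemma expi_inj x y : expi x = expi y -> exists m : int, y = x + 2 * pi * m%:~R.
Proof.
move=> xy; have pi2 := pi_ge2 R.
have yx1 : expi (y - x) = 1 by rewrite expiD -xy mulrC expiN.
(* The 1 is an arbitrary radius below [pi]: it only serves to select [m], and injectivity of the
   cosine on [[0, pi]] then makes the remainder vanish. *)
have cos1_lt : cos 1 < cos (y - x).
  rewrite -[cos (y - x)]/(complex.Re (expi (y - x))) yx1 /= -[ltRHS]cos0.
  by rewrite ltr_cos ?ltr01// in_itv /= ?lexx ?ler01 ?pi_ge0//; lra.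
have one_pi : 0 < (1 : R) < pi by rewrite ltr01; lra.
have [m mP] := cos_near_int one_pi cos1_lt; exists m.
suff v0 : `|y - x - 2 * pi * m%:~R| = 0 by move/normr0_eq0: v0; lra.
apply: cos_inj.
- by rewrite in_itv /= normr_ge0; lra.
- by rewrite in_itv /= lexx pi_ge0.
rewrite cos_norm cos0 -[LHS]/(complex.Re (expi (y - x - 2 * pi * m%:~R))).
by rewrite expiD yx1 mul1r -mulrN -mulrNz expi2piz.
Qed.

End Expi.

(** * Location of the angles when the intermediate elementary symmetric polynomials are small *)

Section NearRoots.
Variables (R : realType) (n : nat) (x : 'rV[R]_n.+1) (d e : R).

Let z j : R[i] := expi (x 0 j).
Let p : {poly R[i]} := \prod_j ('X - (z j)%:P).
Let s := \sum_j x 0 j.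
Let u j := n.+1%:R * x 0 j - s + pi * n%:R.

Hypothesis x_strict : strict_row x.
Hypothesis d_bounds : 0 < d < 1.
Hypothesis d_small : 4 * d * 2 ^+ n.+1 <= 1.
Hypothesis e_ge0 : 0 <= e.
Hypothesis e_small : n.+1%:R * e <= 1.
Hypothesis e_cos : n.+1%:R * e < 1 - cos d.
Hypothesis x_small : forall l, (0 < l <= n)%N -> `|elem_sym l (expi_row x)| <= e%:C.

Let size_p : size p = n.+2.
Proof. by rewrite /p -big_enum size_prod_XsubC size_enum_ord. Qed.

Let coef_p l : (l <= n.+1)%N -> p`_(n.+1 - l) = (-1) ^+ l * elem_sym l (expi_row x).
Proof.
rewrite -ltnS => ln; have := mpoly.mroots_coeff [tuple z j | j < n.+1] (Ordinal ln).
rewrite big_map big_enum /= => ->; congr (_ * mpoly.meval _ _).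
by apply/funext => j; rewrite tnth_mktuple mxE.
Qed.

Let lead_p : p`_n.+1 = 1.
Proof.
have /eqP := monic_prod_XsubC (index_enum 'I_n.+1) xpredT z.
by rewrite lead_coefE size_p.
Qed.

(** The constant term is [(-1)^(n+1)] times the product of the roots; absorbing [(-1)^n] into the
    angle produces the shift by [pi * n%:R]. *)
Let coef0_p : p`_0 = - expi (s - pi * n%:R).
Proof.
rewrite -[0%N](subnn n.+1) coef_p// elem_sym_expi (big_pred1 finset.setT); last first.
  move=> S /=; have cT : #|finset.setT : {set 'I_n.+1}| = n.+1.
    by rewrite cardsT card_ord.
  apply/eqP/eqP => [cS|->//].
  by apply/eqP; rewrite eqEcard finset.subsetT cS cT leqnn.
have sgn : expi (- (pi * n%:R)) = (-1) ^+ n :> R[i].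
  by rewrite -mulNr mulr_natr expiMn expiNpi.
rewrite expiD sgn exprS mulN1r mulNr mulrC; congr (- (expi _ * _)).
by apply: eq_bigl => j; rewrite inE.
Qed.

Let small_p i : (0 < i <= n)%N -> `|p`_i| <= e%:C.
Proof.
move=> /andP[i0 iN]; have := coef_p (leq_subr i n.+1); rewrite subKn; last by lia.
by move=> ->; rewrite normrM normrX normrN1 expr1n mul1r x_small//; lia.
Qed.

Let pE j : p = ('X - (z j)%:P) * \prod_(k | k != j) ('X - (z k)%:P).
Proof. by rewrite /p (bigD1 j). Qed.

(** Evaluating [p] at its root [z j] and factoring out [c] of modulus 1 gives
    [|1 - expi (u j)| <= n e]; the real part yields the claim through [e_cos]. *)
Lemma cos_near_root j : cos d < cos (u j).
Proof.
have := norm_horner_near size_p lead_p (norm_expi (x 0 j)) small_p.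
have -> : p.[expi (x 0 j)] = 0 by rewrite (pE j) !hornerE subrr mul0r.
rewrite sub0r normrN coef0_p -expiMn addrC.
have -> : x 0 j *+ n.+1 = (s - pi * n%:R) + u j by rewrite -mulr_natl /u; ring.
rewrite expiD -{2}[expi (s - _)]mulr1 -mulrBr normrM norm_expi mul1r.
move=> /(le_trans (normc_ge_Re _)); rewrite -rmorphMn lecR /= => uj.
have ne : e *+ n <= n.+1%:R * e.
  by rewrite -[e *+ n]mulr_natl ler_wpM2r ?ler_nat.
have := ler_norm (1 - cos (u j)); rewrite distrC => uj'.
by have := e_cos; lra.
Qed.

(** The derivative of [p] at [z j] is the product of the differences [z j - z i]. Its modulus is at
    least 1, and the factors other than [z j - z k] are at most 2 each. *)
Lemma root_gap j k : j != k -> (2 ^- n.+1)%:C <= `|z j - z k|.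
Proof.
move=> jk; have := norm_horner_deriv_near size_p lead_p (norm_expi (x 0 j)) small_p.
set D := p^`().[_] => hD.
(* [n + 1 <= |D| + e (n + 1) n], and [e_small] bounds the last term by [n]. *)
have D1 : 1 <= `|D|.
  have : `|expi (x 0 j) ^+ n *+ n.+1| <= `|D| + e%:C *+ n.+1 *+ n.
    rewrite -[X in `|X|](subrK D) addrC; apply: le_trans (ler_normD _ _) _.
    by rewrite lerD2l distrC.
  rewrite normrMn normrX norm_expi expr1n => h.
  have en : e%:C *+ n.+1 *+ n <= n%:R :> R[i].
    apply: ler_wMn2r.
    rewrite -(rmorphMn (real_complex R)) -(rmorph1 (real_complex R)) lecR.
    by rewrite -[e *+ _]mulr_natl.
  have := le_trans h (lerD (lexx _) en).
  by rewrite -addn1 natrD addrC lerD2r.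
have DE : D = \prod_(i | i != j) (z j - z i).
  rewrite /D (pE j) horner_deriv_XsubC_mul horner_prod.
  by apply: eq_bigr => i _; rewrite !hornerE.
rewrite DE (bigD1 k) 1?eq_sym//= normrM in D1.
have bound : `|\prod_(i < n.+1 | (i != j) && (i != k)) (z j - z i)| <= 2 ^+ n.+1.
  rewrite normr_prod.
  apply: le_trans (_ : \prod_(i < n.+1 | (i != j) && (i != k)) 2 <= _).
    apply: ler_prod => i _; rewrite normr_ge0 /=.
    by apply: le_trans (ler_normB _ _) _; rewrite !norm_expi.
  rewrite prodr_const ler_eXn2l ?ltr1n//.
  by rewrite -[leqRHS]card_ord max_card.
rewrite -[(2 ^- _)%:C]mul1r.
have -> : (2 ^- n.+1)%:C = (2 ^+ n.+1)^-1 :> R[i] by rewrite fmorphV rmorphXn rmorph_nat.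
rewrite ler_pdivrMr ?exprn_gt0//; apply: le_trans D1 _.
exact: ler_wpM2l.
Qed.

Lemma roots_near j : `|u j - 2 * pi * j%:R| < d.
Proof.
have [d0 d1] := andP d_bounds; have pi2 := pi_ge2 R.
have dpi : 0 < d < pi by rewrite d0; lra.
have /choice [m mP] := fun i => cos_near_int dpi (cos_near_root i).
(* The gap [2 ^- n.+1] is at least [4 * d], and the Lipschitz constant 2 costs a factor of two. Here
   [y] is any lift of [z k]; both [x 0 k] and [x 0 k - 2 * pi] are used. *)
have far (i k : 'I_n.+1) y : i != k -> expi y = z k -> 2 * d <= n.+1%:R * `|x 0 i - y|.
  move=> /root_gap ik yk; move: ik; rewrite -yk => /le_trans /(_ (norm_expiB _ _)).
  rewrite lecR => gap.
  have gap4 : 4 * d <= 2 * `|x 0 i - y|.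
    apply: le_trans gap; rewrite -[leRHS]mul1r ler_pdivlMr ?exprn_gt0//.
  apply: le_trans (_ : 1 * `|x 0 i - y| <= _); first by lra.
  by rewrite ler_wpM2r// ler1n.
(* Each [u i] is within [d] of [2 * pi * m i], while [u k - u i] stays at least [2 * d] away from
   both ends of [[0, 2 * pi * n.+1]]; this forces the strict inequalities between the integers. *)
have mE : forall i, m i = m ord0 + i%:Z.
  apply: int_packed_eq => i k ik.
  have /andP[xik xki] := x_strict ik.
  have ik' : i != k by rewrite neq_ltn ik.
  have := far i k (x 0 k) ik' erefl.
  have e2 : expi (x 0 k - 2 * pi) = z k.
    by rewrite -[LHS]mulr1 -[X in _ * X]expi2pi -expiD subrK.
  have := far i k _ ik' e2.
  have := mP i; have := mP k; rewrite !ltr_norml => /andP[k1 k2] /andP[i1 i2].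
  rewrite gtr0_norm; last by lra.
  rewrite ltr0_norm; last by lra.
  move=> far1 far2; rewrite /u in k1 k2 i1 i2.
  have pim_lt (a b : int) : 2 * pi * a%:~R < 2 * pi * b%:~R :> R -> a < b.
    by rewrite ltr_pM2l ?ltr_int//; lra.
  apply/andP; split; apply: pim_lt; rewrite ?intrD; lra.
have sumj (k : nat) : 2 * \sum_(i < k.+1) i%:R = k%:R * k.+1%:R :> R.
  elim: k => [|k IH]; first by rewrite big_ord1 mulr0 mul0r.
  by rewrite big_ord_recr mulrDr IH /= -!natrM -natrD; congr _%:R; lia.
(* The [u i] sum to [pi n (n + 1)], exactly the sum of the [2 * pi * i], so only the contribution of
   [m ord0] survives. *)
have sumE : \sum_i (u i - 2 * pi * (m i)%:~R) = - (n.+1%:R * (2 * pi * (m ord0)%:~R)).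
  have -> : \sum_i (u i - 2 * pi * (m i)%:~R) =
      \sum_i (n.+1%:R * x 0 i +
        (- s + pi * n%:R - 2 * pi * (m ord0)%:~R) - 2 * pi * i%:R).
    by apply: eq_bigr => i _; rewrite mE intrD /u pmulrn; ring.
  rewrite sumrB big_split /= -!mulr_sumr sumr_const card_ord -/s.
  have -> : \sum_(i < n.+1) i%:R = n%:R * n.+1%:R / 2 :> R by have := sumj n; lra.
  by rewrite -[_ *+ n.+1]mulr_natl; field.
(* Averaging gives [2 pi |m ord0| <= d < 1], and [m ord0] is an integer. *)
have m0 : m ord0 = 0.
  have : n.+1%:R * `|2 * pi * (m ord0)%:~R| <= n.+1%:R * d.
    rewrite -{1}(normr_nat R n.+1) -normrM -normrN -sumE.
    apply: le_trans (ler_norm_sum _ _ _) _.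
    have -> : n.+1%:R * d = \sum_(i < n.+1) d by rewrite sumr_const card_ord mulr_natl.
    by apply: ler_sum => i _; apply: ltW.
  rewrite ler_pM2l ?ltr0n// normrM gtr0_norm; last by lra.
  move=> le_d; have m1 : `|(m ord0)%:~R| < 1 :> R by nra.
  by move: m1; rewrite -intr_norm ltrz1; lia.
by have := mP j; rewrite mE m0 add0r.
Qed.

End NearRoots.

(** * Convergence of the angles and of the process, and independence of the chosen angles *)

Section Limit.
Variable R : realType.

Lemma solution_cvg n (X : R -> 'rV[R]_n.+1) (d : R) : is_solution X -> 0 < d ->
  \forall t \near +oo, forall j,
    `|X t 0 j - ((\sum_j X 0 0 j - pi * n%:R) / n.+1%:R + 2 * pi * j%:R / n.+1%:R)| < d.
Proof.
move=> Xsol d0; have pi2 := pi_ge2 R.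
(* The second bound is the condition [4 * d' * 2 ^+ n.+1 <= 1] of [roots_near]; it also gives
   [d' < 1]. *)
pose d' : R := Num.min d (4 * 2 ^+ n.+1)^-1.
have q0 : 0 < 4 * 2 ^+ n.+1 :> R by rewrite mulr_gt0 ?exprn_gt0.
have d'0 : 0 < d' by rewrite lt_min d0 invr_gt0.
have d'd : d' <= d by rewrite ge_min lexx.
have d'q : 4 * d' * 2 ^+ n.+1 <= 1.
  by rewrite mulrAC mulrC -ler_pdivlMr// div1r ge_min lexx orbT.
have d'1 : d' < 1.
  have : 1 <= 2 ^+ n.+1 :> R by rewrite exprn_ege1 ?ler1n.
  by nra.
have cosd : 0 < 1 - cos d'.
  rewrite subr_gt0 -cos0 ltr_cos//= in_itv /=; apply/andP; split; lra.
(* The 1 in the minimum gives [n.+1%:R * e <= 1]; the halved term gives the strict bound by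
   [1 - cos d']. *)
pose e : R := Num.min 1 ((1 - cos d') / 2) / n.+1%:R.
have n0 : 0 < n.+1%:R :> R by rewrite ltr0n.
have eE : n.+1%:R * e = Num.min 1 ((1 - cos d') / 2) by rewrite /e mulrC divfK ?gt_eqF.
have min0 : 0 < Num.min 1 ((1 - cos d') / 2) by rewrite lt_min ltr01 divr_gt0.
have e0 : 0 < e by rewrite divr_gt0.
(* [M] dominates the initial moduli for all [l <= n]. The modulus on [R[i]] takes values in [R[i]],
   hence the real part. *)
pose M : R := \sum_(l < n.+1) complex.Re `|elem_sym l (expi_row (X 0))|.
have M0 l : `|elem_sym l (expi_row (X 0))| =
    (complex.Re `|elem_sym l (expi_row (X 0))|)%:C.
  by rewrite RRe_real ?normr_real.
have M1 l : 0 <= complex.Re `|elem_sym l (expi_row (X 0))|.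
  by rewrite -lecR -M0; exact: normr_ge0.
have := @cvgr_expR R.
move=> /cvgrPdist_lt /(_ (e / (M + 1))).
have Mge0 : 0 <= M by apply: sumr_ge0 => i _; apply: M1.
have eM : 0 < e / (M + 1) by rewrite divr_gt0 ?ltr_pwDr.
move=> /(_ eM) near_e; near=> t.
have t0 : 0 <= t by near: t; apply: nbhs_pinfty_ge; rewrite num_real.
have te : expR (- t) < e / (M + 1).
  have : `|0 - expR (- t)| < e / (M + 1) by near: t.
  by rewrite sub0r normrN gtr0_norm// expR_gt0.
have Xt : strict_row (X t) by apply: interior_C_N; case: Xsol => h _ _; apply: h.
have small l : (0 < l <= n)%N -> `|elem_sym l (expi_row (X t))| <= e%:C.
  move=> /andP[l0 ln]; rewrite elem_sym_solution// normrM M0.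
  rewrite ger0_norm ?ler0c ?expR_ge0// -rmorphM lecR.
  have lM : complex.Re `|elem_sym l (expi_row (X 0))| <= M.
    rewrite /M (bigD1 (Ordinal (ln : (l < n.+1)%N)))//= lerDl.
    by apply: sumr_ge0 => i _; apply: M1.
  (* For [0 < l < n.+1] the rate [l (n + 1 - l)] is at least 1, so [expR (- t)] controls all these
     decays at once. *)
  have exple : expR (- (l%:R * (n.+1%:R - l%:R) * t)) <= expR (- t).
    rewrite ler_expR lerN2 -natrB 1?ltnW// -natrM ler_peMl// ler1n muln_gt0 l0.
    by rewrite subn_gt0.
  apply: le_trans (ler_pM _ _ exple lM) _ => //; first exact: expR_ge0.
  have : expR (- t) * (M + 1) < e by rewrite -ltr_pdivlMr// ltr_pwDr.
  by have := expR_gt0 (- t); nra.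
move=> j; rewrite -(sum_solution Xsol t0).
have d'b : 0 < d' < 1 by rewrite d'0.
have en : n.+1%:R * e <= 1 by rewrite eE ge_min lexx.
have ec : n.+1%:R * e < 1 - cos d'.
  by rewrite eE gt_min; apply/orP; right; lra.
have := roots_near Xt d'b d'q (ltW e0) en ec small j.
set s := \sum_j _ => h.
have -> : X t 0 j - ((s - pi * n%:R) / n.+1%:R + 2 * pi * j%:R / n.+1%:R) =
  (n.+1%:R * X t 0 j - s + pi * n%:R - 2 * pi * j%:R) / n.+1%:R.
  by field; rewrite addrC natr1 pnatr_eq0.
rewrite normrM normfV (ger0_norm (ler0n _ _)) ltr_pdivrMr//.
apply: lt_le_trans h _; apply: le_trans d'd _.
by rewrite ler_peMr ?ler1n// ltW.
Unshelve. all: by end_near. Qed.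

(** Coordinate differences lie strictly between 0 and [2 * pi] for [x], and in the closed interval
    for [y]. The two differences thus differ by less than [2 * pi], all [m j] agree, and the mean
    moves by a multiple of [2 * pi]. *)
Lemma expi_mean_unique n (x y : 'rV[R]_n.+1) : strict_row x -> C_N y ->
  expi_row x = expi_row y ->
  expi ((\sum_j x 0 j - pi * n%:R) / n.+1%:R) =
  expi ((\sum_j y 0 j - pi * n%:R) / n.+1%:R).
Proof.
move=> xs yC xy; have pi0 := pi_gt0 R.
have /choice [m mP] : forall j, exists m : int, y 0 j = x 0 j + 2 * pi * m%:~R.
  by move=> j; apply: expi_inj; have /rowP /(_ j) := xy; rewrite !mxE.
have mE j : m j = m ord0.
  case: (posnP j) => [j0|j0]; first by congr m; apply: val_inj.
  have /andP[x1 x2] := xs ord0 j j0.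
  have /andP[y1 y2] := yC ord0 j (ltnW j0).
  move: y1 y2; rewrite !mP => y1 y2.
  have pim_lt (a b : int) : 2 * pi * a%:~R < 2 * pi * b%:~R :> R -> a < b.
    by rewrite ltr_pM2l ?ltr_int//; lra.
  have h1 : m j < m ord0 + 1 by apply: pim_lt; rewrite intrD; lra.
  have h2 : m ord0 < m j + 1 by apply: pim_lt; rewrite intrD; lra.
  by lia.
have -> : \sum_j y 0 j = \sum_j x 0 j + n.+1%:R * (2 * pi * (m ord0)%:~R).
  under eq_bigr do rewrite mP mE.
  by rewrite big_split /= sumr_const card_ord -[_ *+ n.+1]mulr_natl.
have -> : (\sum_j x 0 j + n.+1%:R * (2 * pi * (m ord0)%:~R) - pi * n%:R) / n.+1%:R =
  (\sum_j x 0 j - pi * n%:R) / n.+1%:R + 2 * pi * (m ord0)%:~R.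
  by field; rewrite addrC natr1 pnatr_eq0.
by rewrite expiD expi2piz mulr1.
Qed.

End Limit.

Theorem corollary3p6 (R : realType) (N : nat) (hN : (2 <= N)%N)
    (z : 'rV[R[i]]_N) (hz : interior_A_N z)
    (Z : R -> 'rV[R[i]]_N) (hZ : deterministic_process z Z) :
  (forall (l : nat) (t : R), (l <= N)%N -> 0 <= t ->
     elem_sym l (Z t) = (expR (- (l%:R * (N%:R - l%:R) * t)))%:C * elem_sym l z) /\
  exists Z1 : R[i],
    [/\ `|Z1| = 1,
        Z t @[t --> +oo] -->
          (\row_(j < N) (Z1 * expi (2 * pi * j%:R / N%:R)) : 'rV[R[i]]_N) &
        forall x : 'rV[R]_N, C_N x -> z = expi_row x ->
          Z1 = expi ((\sum_(j < N) x 0 j - pi * (N%:R - 1)) / N%:R)].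
Proof.
case: N hN z hz Z hZ => [//|n] _ z hz Z [X [Xsol Xz ZX]].
split=> [l t _ t0|]; first by rewrite ZX// elem_sym_solution// Xz.
exists (expi ((\sum_j X 0 0 j - pi * n%:R) / n.+1%:R)); split.
- exact: norm_expi.
- apply/cvg_ballP => eps eps0.
  (* Radii of balls in [R[i]] are themselves elements of [R[i]]; a positive one is real. *)
  have epsE : eps = (complex.Re eps)%:C by rewrite RRe_real ?gtr0_real.
  have r0 : 0 < complex.Re eps by rewrite -ltcR -epsE.
  (* Half the radius compensates the constant 2 of [norm_expiB]. *)
  have near_x := solution_cvg Xsol (divr_gt0 r0 (ltr0n R 2)).
  near=> t; have t0 : 0 <= t by near: t; apply: nbhs_pinfty_ge; rewrite num_real.
  have xt : forall j, `|X t 0 j - ((\sum_j X 0 0 j - pi * n%:R) / n.+1%:R +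
      2 * pi * j%:R / n.+1%:R)| < complex.Re eps / 2 by near: t.
  split => // i j; rewrite !mxE -expiD ZX// mxE /ball /= distrC.
  apply: le_lt_trans (norm_expiB _ _) _; rewrite epsE ltcR mulrC -ltr_pdivlMr//.
  by rewrite ord1.
- move=> x xC zx; have -> : n.+1%:R - 1 = n%:R :> R by rewrite -natr1 addrK.
  apply: expi_mean_unique => //; last by rewrite Xz.
  by apply: interior_C_N; case: Xsol => h _ _; apply: h.
Unshelve. all: by end_near. Qed.
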